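(* Let $\mathsf{C}$ be a Markov category which has conditionals, and let $\psi:I\to X\otimes W$ and $\phi:I\to W\otimes Y$ be morphisms with equal marginals on $W$. Then the conditional product $\psi\otimes_W\phi$ is the unique morphism $I\to X\otimes W\otimes Y$ which marginalizes to both $\psi$ (on $X\otimes W$) and $\phi$ (on $W\otimes Y$) and displays the conditional independence $X\perp Y\,|\,W$.
   Context: A Markov category is a symmetric monoidal category $(\mathsf{C},\otimes,I)$ with symmetry $\mathsf{swap}_{X,Y}:X\otimes Y\to Y\otimes X$, in which every object $X$ is equipped with morphisms $\mathsf{copy}_X:X\to X\otimes X$ and $\mathsf{del}_X:X\to I$ forming a commutative comonoid (coassociative, counital, cocommutative), such that: (i) $\mathsf{del}_{X\otimes Y}$ is $\mathsf{del}_X\otimes\mathsf{del}_Y$ followed by $I\otimes I\cong I$; (ii) $\mathsf{copy}_{X\otimes Y}$ is $\mathsf{copy}_X\otimes\mathsf{copy}_Y$ followed by the canonical isomorphism $(X\otimes X)\otimes(Y\otimes Y)\cong(X\otimes Y)\otimes(X\otimes Y)$ swapping the two middle factors; (iii) $\mathsf{del}_Y\circ f=\mathsf{del}_X$ for every $f:X\to Y$. Associators and unitors are suppressed in formulas. Write $\mathsf{copy}^{(3)}_W:=(\mathsf{copy}_W\otimes\mathrm{id}_W)\circ\mathsf{copy}_W:W\to W\otimes W\otimes W$. The marginal of a morphism on some of its output factors is obtained by composing with $\mathsf{del}$ on all the other output factors. $\mathsf{C}$ has conditionals if for every $f:A\to X\otimes Y$ there is $f_{|X}:X\otimes A\to Y$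 such that $f=(\mathrm{id}_X\otimes f_{|X})\circ(\mathsf{copy}_X\otimes\mathrm{id}_A)\circ(f_X\otimes\mathrm{id}_A)\circ\mathsf{copy}_A$, where $f_X:=(\mathrm{id}_X\otimes\mathsf{del}_Y)\circ f$. Conditionals on another output factor are defined by first permuting the outputs. Conditional product: for $\psi:I\to X\otimes W$ and $\phi:I\to W\otimes Y$ with the same marginal $\omega:I\to W$, put $\psi\otimes_W\phi:=(\psi_{|W}\otimes\mathrm{id}_W\otimes\phi_{|W})\circ\mathsf{copy}^{(3)}_W\circ\omega:I\to X\otimes W\otimes Y$, where $\psi_{|W}:W\to X$ and $\phi_{|W}:W\to Y$ are any conditionals of $\psi$ and $\phi$ on $W$ (the result does not depend on the choice of conditionals). A morphism $\eta:I\to X\otimes W\otimes Y$ displays the conditional independence $X\perp Y\,|\,W$ if there are $f:W\to X$, $g:W\to Y$ and $\chi:I\to W$ such that $\eta=(f\otimes\mathrm{id}_W\otimes g)\circ\mathsf{copy}^{(3)}_W\circ\chi$. *)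

(* Defs.v *)
Set Implicit Arguments.
Unset Strict Implicit.
Unset Printing Implicit Defensive.

Declare Scope markov_scope.
Delimit Scope markov_scope with markov.
Local Open Scope markov_scope.

Reserved Notation "g ∘ f" (at level 40, left associativity).
Reserved Notation "X ⊗ Y" (at level 30, no associativity).
Reserved Notation "f ⊠ g" (at level 30, no associativity).

Record category := Category {
  ob :> Type;
  hom : ob -> ob -> Type;
  idm : forall X, hom X X;
  comp : forall X Y Z, hom Y Z -> hom X Y -> hom X Z;
  comp_idl : forall X Y (f : hom X Y), comp (idm Y) f = f;
  comp_idr : forall X Y (f : hom X Y), comp f (idm X) = f;
  compA : forall X Y Z T (h : hom Z T) (g : hom Y Z) (f : hom X Y),
    comp h (comp g f) = comp (comp h g) f
}.

Arguments hom {c} X Y.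
Arguments idm {c} X.
Arguments comp {c X Y Z} g f.

Notation "g ∘ f" := (comp g f) : markov_scope.

(* [X ⊗ Y] is the tensor of objects, [f ⊠ g] the tensor of morphisms. The
   second hexagon and the compatibility of [swap] with the unitors follow from
   the axioms below. *)
Record symmetric_monoidal_category := SymmetricMonoidalCategory {
  smc_category :> category;
  tens : smc_category -> smc_category -> smc_category
    where "X ⊗ Y" := (tens X Y);
  unit_ob : smc_category;
  tensm : forall X X' Y Y' : smc_category,
    hom X X' -> hom Y Y' -> hom (X ⊗ Y) (X' ⊗ Y')
    where "f ⊠ g" := (tensm f g);
  tensm_id : forall X Y, idm X ⊠ idm Y = idm (X ⊗ Y);
  tensm_comp : forall X X' X'' Y Y' Y'' (f' : hom X' X'') (f : hom X X')
      (g' : hom Y' Y'') (g : hom Y Y'),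
    (f' ∘ f) ⊠ (g' ∘ g) = (f' ⊠ g') ∘ (f ⊠ g);

  assoc : forall X Y Z, hom ((X ⊗ Y) ⊗ Z) (X ⊗ (Y ⊗ Z));
  assoc_inv : forall X Y Z, hom (X ⊗ (Y ⊗ Z)) ((X ⊗ Y) ⊗ Z);
  assocK : forall X Y Z, assoc_inv X Y Z ∘ assoc X Y Z = idm _;
  assoc_invK : forall X Y Z, assoc X Y Z ∘ assoc_inv X Y Z = idm _;
  assoc_nat : forall X X' Y Y' Z Z'
      (f : hom X X') (g : hom Y Y') (h : hom Z Z'),
    assoc X' Y' Z' ∘ ((f ⊠ g) ⊠ h) = (f ⊠ (g ⊠ h)) ∘ assoc X Y Z;

  lunit : forall X, hom (unit_ob ⊗ X) X;
  lunit_inv : forall X, hom X (unit_ob ⊗ X);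
  lunitK : forall X, lunit_inv X ∘ lunit X = idm _;
  lunit_invK : forall X, lunit X ∘ lunit_inv X = idm _;
  lunit_nat : forall X Y (f : hom X Y),
    lunit Y ∘ (idm unit_ob ⊠ f) = f ∘ lunit X;

  runit : forall X, hom (X ⊗ unit_ob) X;
  runit_inv : forall X, hom X (X ⊗ unit_ob);
  runitK : forall X, runit_inv X ∘ runit X = idm _;
  runit_invK : forall X, runit X ∘ runit_inv X = idm _;
  runit_nat : forall X Y (f : hom X Y),
    runit Y ∘ (f ⊠ idm unit_ob) = f ∘ runit X;

  triangle : forall X Y,
    (idm X ⊠ lunit Y) ∘ assoc X unit_ob Y = runit X ⊠ idm Y;
  pentagon : forall X Y Z T,
    (idm X ⊠ assoc Y Z T) ∘ assoc X (Y ⊗ Z) T ∘ (assoc X Y Z ⊠ idm T)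
    = assoc X Y (Z ⊗ T) ∘ assoc (X ⊗ Y) Z T;

  swap : forall X Y, hom (X ⊗ Y) (Y ⊗ X);
  swapK : forall X Y, swap Y X ∘ swap X Y = idm _;
  swap_nat : forall X X' Y Y' (f : hom X X') (g : hom Y Y'),
    swap X' Y' ∘ (f ⊠ g) = (g ⊠ f) ∘ swap X Y;
  hexagon : forall X Y Z,
    assoc Y Z X ∘ swap X (Y ⊗ Z) ∘ assoc X Y Z
    = (idm Y ⊠ swap X Z) ∘ assoc Y X Z ∘ (swap X Y ⊠ idm Z)
}.

Arguments unit_ob {s}.
Arguments tens {s} X Y.
Arguments tensm {s X X' Y Y'} f g.
Arguments assoc {s} X Y Z.
Arguments assoc_inv {s} X Y Z.
Arguments lunit {s} X.
Arguments lunit_inv {s} X.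
Arguments runit {s} X.
Arguments runit_inv {s} X.
Arguments swap {s} X Y.

Notation "X ⊗ Y" := (tens X Y) : markov_scope.
Notation "f ⊠ g" := (tensm f g) : markov_scope.

Definition swap_middle (C : symmetric_monoidal_category) (X X' Y Y' : C) :
    hom ((X ⊗ X') ⊗ (Y ⊗ Y')) ((X ⊗ Y) ⊗ (X' ⊗ Y')) :=
  assoc_inv X Y (X' ⊗ Y')
  ∘ (idm X ⊠ (assoc Y X' Y' ∘ (swap X' Y ⊠ idm Y') ∘ assoc_inv X' Y Y'))
  ∘ assoc X X' (Y ⊗ Y').

Record markov_category := MarkovCategory {
  markov_smc :> symmetric_monoidal_category;
  copy : forall X : markov_smc, hom X (X ⊗ X);
  del : forall X : markov_smc, hom X unit_ob;
  copy_coassoc : forall X,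
    assoc X X X ∘ (copy X ⊠ idm X) ∘ copy X = (idm X ⊠ copy X) ∘ copy X;
  copy_counitl : forall X, lunit X ∘ (del X ⊠ idm X) ∘ copy X = idm X;
  copy_counitr : forall X, runit X ∘ (idm X ⊠ del X) ∘ copy X = idm X;
  copy_cocomm : forall X, swap X X ∘ copy X = copy X;
  del_tens : forall X Y, del (X ⊗ Y) = lunit unit_ob ∘ (del X ⊠ del Y);
  copy_tens : forall X Y,
    copy (X ⊗ Y) = swap_middle X X Y Y ∘ (copy X ⊠ copy Y);
  del_nat : forall X Y (f : hom X Y), del Y ∘ f = del X
}.

Arguments copy {m} X.
Arguments del {m} X.

Section MarkovCategoryTheory.
Variable C : markov_category.
Implicit Types A X W Y : C.

Definition marginal_fst A X Y (f : hom A (X ⊗ Y)) : hom A X :=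
  runit X ∘ (idm X ⊠ del Y) ∘ f.

Definition marginal_snd A X Y (f : hom A (X ⊗ Y)) : hom A Y :=
  lunit Y ∘ (del X ⊠ idm Y) ∘ f.

Definition is_conditional A X Y (f : hom A (X ⊗ Y)) (c : hom (X ⊗ A) Y) : Prop :=
  f = (idm X ⊠ c) ∘ assoc X X A ∘ (copy X ⊠ idm A)
      ∘ (marginal_fst f ⊠ idm A) ∘ copy A.

Definition has_conditionals : Prop :=
  forall A X Y (f : hom A (X ⊗ Y)), exists c : hom (X ⊗ A) Y, is_conditional f c.

(* For a state, the domain [W ⊗ unit_ob] of a conditional is identified with
   [W] along the right unitor. *)
Definition is_conditional_on_fst W Y (phi : hom unit_ob (W ⊗ Y)) (d : hom W Y) :
    Prop :=
  is_conditional phi (d ∘ runit W).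

Definition is_conditional_on_snd X W (psi : hom unit_ob (X ⊗ W)) (c : hom W X) :
    Prop :=
  is_conditional_on_fst (swap X W ∘ psi) c.

Definition copy3 W : hom W ((W ⊗ W) ⊗ W) := (copy W ⊠ idm W) ∘ copy W.

(* Triple tensor products are bracketed to the left. *)
Definition is_conditional_product X W Y (psi : hom unit_ob (X ⊗ W))
    (phi : hom unit_ob (W ⊗ Y)) (eta : hom unit_ob ((X ⊗ W) ⊗ Y)) : Prop :=
  exists (omega : hom unit_ob W) (c : hom W X) (d : hom W Y),
    marginal_snd psi = omega /\ marginal_fst phi = omega /\
    is_conditional_on_snd psi c /\ is_conditional_on_fst phi d /\
    eta = ((c ⊠ idm W) ⊠ d) ∘ copy3 W ∘ omega.

Definition displays_cond_indep X W Y (eta : hom unit_ob ((X ⊗ W) ⊗ Y)) : Prop :=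
  exists (f : hom W X) (g : hom W Y) (chi : hom unit_ob W),
    eta = ((f ⊠ idm W) ⊠ g) ∘ copy3 W ∘ chi.

Definition marginal_XW X W Y (eta : hom unit_ob ((X ⊗ W) ⊗ Y)) :
    hom unit_ob (X ⊗ W) :=
  marginal_fst eta.

Definition marginal_WY X W Y (eta : hom unit_ob ((X ⊗ W) ⊗ Y)) :
    hom unit_ob (W ⊗ Y) :=
  marginal_snd (assoc X W Y ∘ eta).

End MarkovCategoryTheory.

(* Main.v *)
(** Both a conditional product and a state displaying [X ⊥ Y | W] have the form
[((f ⊠ id) ⊠ g) ∘ copy3 ∘ χ]. Deleting [Y], [X] or both, counitality shows that
the marginals of such a state are [(f ⊠ id) ∘ copy ∘ χ], [(id ⊠ g) ∘ copy ∘ χ]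
and [χ]. Hence it has marginals [psi] and [phi] exactly when [χ] is their common
marginal and [f], [g] are conditionals of them, that is, when it is a conditional
product. Conditional products are unique because
[((f ⊠ id) ⊠ g) ∘ copy3 ∘ χ] depends on [f] only through [(f ⊠ id) ∘ copy ∘ χ]
(by coassociativity) and on [g] only through [(id ⊠ g) ∘ copy ∘ χ]. *)

From Stdlib Require Import ssreflect Setoid.
Require Import Defs.

Local Open Scope markov_scope.

Set Implicit Arguments.
Unset Strict Implicit.

Section Coherence.
Variable C : symmetric_monoidal_category.
Implicit Types X Y Z W : C.

Lemma tensm_comp_l X X' X'' Y Y' (f' : hom X' X'') (f : hom X X')
    (g : hom Y Y') :
  (f' ⊠ g) ∘ (f ⊠ idm Y) = (f' ∘ f) ⊠ g.
Proof. by rewrite -tensm_comp comp_idr. Qed.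

Lemma tensm_comp_r X X' Y Y' Y'' (f : hom X X') (g' : hom Y' Y'')
    (g : hom Y Y') :
  (f ⊠ g') ∘ (idm X ⊠ g) = f ⊠ (g' ∘ g).
Proof. by rewrite -tensm_comp comp_idr. Qed.

Lemma split_epi_cancel X Y Z (e : hom X Y) (s : hom Y X) (f g : hom Y Z) :
  e ∘ s = idm Y -> f ∘ e = g ∘ e -> f = g.
Proof.
move=> es fg; rewrite -[f]comp_idr -[g]comp_idr -es.
by rewrite !compA fg.
Qed.

Lemma split_mono_cancel X Y Z (m : hom Y Z) (r : hom Z Y) (f g : hom X Y) :
  r ∘ m = idm Y -> m ∘ f = m ∘ g -> f = g.
Proof.
move=> rm fg; rewrite -[f]comp_idl -[g]comp_idl -rm.
by rewrite -!compA fg.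
Qed.

(** Naturality of [runit] recovers [f] from [f ⊠ idm unit_ob] by conjugation, so coherence
    identities may be checked after tensoring with the unit. *)
Lemma tensm_unit_r_inj X Y (f g : hom X Y) :
  f ⊠ idm (@unit_ob C) = g ⊠ idm unit_ob -> f = g.
Proof.
move=> fg; apply: (split_epi_cancel (runit_invK X)).
by rewrite -!runit_nat fg.
Qed.

Lemma tensm_unit_l_inj X Y (f g : hom X Y) :
  idm (@unit_ob C) ⊠ f = idm unit_ob ⊠ g -> f = g.
Proof.
move=> fg; apply: (split_epi_cancel (lunit_invK X)).
by rewrite -!lunit_nat fg.
Qed.

(** Kelly's argument: after tensoring with [unit_ob] on the right, the pentagon for [X], [Y],
    [unit_ob], [unit_ob] and two triangles identify both sides. *)
Lemma runit_tens X Y : (idm X ⊠ runit Y) ∘ assoc X Y unit_ob = runit (X ⊗ Y).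
Proof.
apply: tensm_unit_r_inj; apply: (split_mono_cancel (assocK X Y unit_ob)).
rewrite -triangle compA -tensm_id assoc_nat -compA -pentagon !compA.
by rewrite tensm_comp_r triangle -assoc_nat -compA tensm_comp_l.
Qed.

Lemma runit_tens_unit X : runit (X ⊗ unit_ob) = runit X ⊠ idm unit_ob.
Proof.
by apply: (split_mono_cancel (runitK X)); rewrite runit_nat.
Qed.

Lemma lunit_unit : lunit (@unit_ob C) = runit unit_ob.
Proof.
apply: tensm_unit_l_inj; apply: (split_epi_cancel (assoc_invK _ _ _)).
by rewrite triangle runit_tens runit_tens_unit.
Qed.

(** Precomposed with invertible maps, both sides become [swap X unit_ob ∘ runit (X ⊗ unit_ob)], by
    the hexagon for [X], [unit_ob], [unit_ob] and the triangle. *)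
Lemma lunit_swap X : lunit X ∘ swap X unit_ob = runit X.
Proof.
apply: tensm_unit_l_inj.
have swapK' : (swap X (@unit_ob C) ⊠ idm (@unit_ob C)) ∘ (swap unit_ob X ⊠ idm unit_ob)
    = idm _ by rewrite tensm_comp_l swapK tensm_id.
apply: (split_epi_cancel (assoc_invK unit_ob X unit_ob)).
apply: (split_epi_cancel swapK').
rewrite -tensm_comp_r -!compA (compA (idm _ ⊠ swap _ _)) -hexagon !compA triangle.
by rewrite -swap_nat -!compA runit_tens compA runit_tens runit_nat.
Qed.

Lemma runit_swap X : runit X ∘ swap unit_ob X = lunit X.
Proof. by rewrite -lunit_swap -compA swapK comp_idr. Qed.

End Coherence.

Section MarkovCategory.
Variable C : markov_category.
Implicit Types A X W Y : C.

(** Counitality writes the identity as [del unit_ob] after an endomorphism of [unit_ob], and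
    naturality of [del] absorbs the latter. *)
Lemma del_unit : del (@unit_ob C) = idm unit_ob.
Proof.
rewrite -(copy_counitl unit_ob) lunit_unit runit_nat -compA.
by rewrite del_nat.
Qed.

Lemma runit_copy_unit : runit unit_ob ∘ copy (@unit_ob C) = idm unit_ob.
Proof. by rewrite -[RHS]copy_counitr del_unit tensm_id comp_idr. Qed.

Lemma marginal_fst_swap A X W (f : hom A (X ⊗ W)) :
  marginal_fst (swap X W ∘ f) = marginal_snd f.
Proof.
rewrite /marginal_fst /marginal_snd !compA -(compA _ _ (swap X W)).
by rewrite -swap_nat compA runit_swap.
Qed.

Lemma marginal_fst_tensm_copy A W Y (g : hom W Y) (chi : hom A W) :
  marginal_fst ((idm W ⊠ g) ∘ copy W ∘ chi) = chi.
Proof.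
rewrite /marginal_fst !compA -(compA _ _ (idm W ⊠ g)) tensm_comp_r del_nat.
by rewrite copy_counitr comp_idl.
Qed.

(** Naturality moves the unitor of [d ∘ runit W] down to [copy unit_ob], which it cancels; the
    trivial input disappears. *)
Lemma is_conditional_on_fstE W Y (phi : hom unit_ob (W ⊗ Y)) (d : hom W Y) :
  is_conditional_on_fst phi d
  <-> phi = (idm W ⊠ d) ∘ copy W ∘ marginal_fst phi.
Proof.
rewrite /is_conditional_on_fst /is_conditional.
suff -> : (idm W ⊠ (d ∘ runit W)) ∘ assoc W W unit_ob ∘ (copy W ⊠ idm unit_ob)
    ∘ (marginal_fst phi ⊠ idm unit_ob) ∘ copy unit_ob
  = (idm W ⊠ d) ∘ copy W ∘ marginal_fst phi by [].
rewrite -tensm_comp_r -(compA _ _ (assoc _ _ _)) runit_tens.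
rewrite -!compA (compA (runit _)) runit_nat -!compA (compA (runit W)) runit_nat.
by rewrite -compA runit_copy_unit comp_idr.
Qed.

Lemma swap_tensm_copy W X (c : hom W X) :
  swap W X ∘ (idm W ⊠ c) ∘ copy W = (c ⊠ idm W) ∘ copy W.
Proof. by rewrite swap_nat -compA copy_cocomm. Qed.

Lemma is_conditional_on_sndE X W (psi : hom unit_ob (X ⊗ W)) (c : hom W X) :
  is_conditional_on_snd psi c
  <-> psi = (c ⊠ idm W) ∘ copy W ∘ marginal_snd psi.
Proof.
rewrite /is_conditional_on_snd is_conditional_on_fstE marginal_fst_swap.
rewrite -swap_tensm_copy -!compA.
by split=> [<-|{1}->]; rewrite compA swapK comp_idl.
Qed.

Lemma has_conditionals_on_fst (hC : has_conditionals C) W Y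
    (phi : hom unit_ob (W ⊗ Y)) :
  exists d : hom W Y, is_conditional_on_fst phi d.
Proof.
have [c hc] := hC _ _ _ phi; exists (c ∘ runit_inv W).
by rewrite /is_conditional_on_fst -compA runitK comp_idr.
Qed.

Lemma tensm_copy3 X W Y (f : hom W X) (g : hom W Y) :
  ((f ⊠ idm W) ⊠ g) ∘ copy3 W = (((f ⊠ idm W) ∘ copy W) ⊠ g) ∘ copy W.
Proof. by rewrite /copy3 compA tensm_comp_l. Qed.

(** Coassociativity groups the middle copy with [g] instead of [f], mirroring [tensm_copy3]. *)
Lemma assoc_tensm_copy3 X W Y (f : hom W X) (g : hom W Y) :
  assoc X W Y ∘ ((f ⊠ idm W) ⊠ g) ∘ copy3 W
  = (f ⊠ ((idm W ⊠ g) ∘ copy W)) ∘ copy W.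
Proof.
by rewrite /copy3 assoc_nat -compA (compA (assoc _ _ _)) copy_coassoc compA
  tensm_comp_r.
Qed.

Section DisplayedState.
Variables (X W Y : C) (f : hom W X) (g : hom W Y) (chi : hom unit_ob W).
Let eta := ((f ⊠ idm W) ⊠ g) ∘ copy3 W ∘ chi.

Lemma marginal_XW_displayed : marginal_XW eta = (f ⊠ idm W) ∘ copy W ∘ chi.
Proof.
rewrite /marginal_XW /marginal_fst /eta tensm_copy3 !compA.
rewrite -(compA _ (idm _ ⊠ del Y)) -tensm_comp del_nat comp_idl.
(* Splitting off the deletion lets [runit] slide inward until it meets [copy W], where the counit
   law applies. *)
have -> : ((f ⊠ idm W) ∘ copy W) ⊠ del W
    = (((f ⊠ idm W) ∘ copy W) ⊠ idm unit_ob) ∘ (idm W ⊠ del W).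
  by rewrite tensm_comp_r comp_idl.
by rewrite !compA runit_nat -(compA _ _ (idm W ⊠ del W)) -(compA _ _ (copy W))
  copy_counitr comp_idr.
Qed.

Lemma marginal_WY_displayed : marginal_WY eta = (idm W ⊠ g) ∘ copy W ∘ chi.
Proof.
rewrite /marginal_WY /marginal_snd /eta (compA (assoc _ _ _)).
rewrite (compA (assoc _ _ _)) assoc_tensm_copy3 !compA.
rewrite -(compA _ (del X ⊠ idm _)) -tensm_comp del_nat comp_idl.
have -> : del W ⊠ ((idm W ⊠ g) ∘ copy W)
    = (idm unit_ob ⊠ ((idm W ⊠ g) ∘ copy W)) ∘ (del W ⊠ idm W).
  by rewrite tensm_comp_l comp_idl.
by rewrite !compA lunit_nat -(compA _ _ (del W ⊠ idm W)) -(compA _ _ (copy W))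
  copy_counitl comp_idr.
Qed.

(** The state is rebuilt by generating [Y] from the [W] output of its marginal, so [f] enters only
    through that marginal. *)
Lemma displayed_via_XW :
  eta = assoc_inv X W Y ∘ (idm X ⊠ ((idm W ⊠ g) ∘ copy W)) ∘ marginal_XW eta.
Proof.
rewrite marginal_XW_displayed !compA -(compA _ _ (f ⊠ idm W)) -tensm_comp.
rewrite comp_idl comp_idr -(compA _ _ (copy W)) -assoc_tensm_copy3 !compA.
by rewrite assocK comp_idl /eta /copy3 !compA.
Qed.

Lemma displayed_via_WY :
  eta = (((f ⊠ idm W) ∘ copy W) ⊠ idm Y) ∘ marginal_WY eta.
Proof.
by rewrite marginal_WY_displayed !compA tensm_comp_r comp_idl /eta tensm_copy3.
Qed.

End DisplayedState.

Lemma displayed_eq X W Y (f f' : hom W X) (g g' : hom W Y)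
    (chi : hom unit_ob W) :
  (f ⊠ idm W) ∘ copy W ∘ chi = (f' ⊠ idm W) ∘ copy W ∘ chi ->
  (idm W ⊠ g) ∘ copy W ∘ chi = (idm W ⊠ g') ∘ copy W ∘ chi ->
  ((f ⊠ idm W) ⊠ g) ∘ copy3 W ∘ chi = ((f' ⊠ idm W) ⊠ g') ∘ copy3 W ∘ chi.
Proof.
(* The mixed state shares [g] with the left side and [f'] with the right, so each half compares a
   single marginal. *)
move=> hf hg; transitivity (((f' ⊠ idm W) ⊠ g) ∘ copy3 W ∘ chi).
  by rewrite [LHS]displayed_via_XW [RHS]displayed_via_XW !marginal_XW_displayed hf.
by rewrite [LHS]displayed_via_WY [RHS]displayed_via_WY !marginal_WY_displayed hg.
Qed.

Lemma is_conditional_productE X W Y (psi : hom unit_ob (X ⊗ W))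
    (phi : hom unit_ob (W ⊗ Y)) (hW : marginal_snd psi = marginal_fst phi)
    (eta : hom unit_ob ((X ⊗ W) ⊗ Y)) :
  is_conditional_product psi phi eta
  <-> marginal_XW eta = psi /\ marginal_WY eta = phi /\ displays_cond_indep eta.
Proof.
split.
  move=> [omega [c [d [psiW [phiW [hc [hd ->]]]]]]].
  move/is_conditional_on_sndE: hc; rewrite psiW => hc.
  move/is_conditional_on_fstE: hd; rewrite phiW => hd.
  rewrite marginal_XW_displayed marginal_WY_displayed -hc -hd.
  by do 2!split=> //; exists c, d, omega.
move=> [psiE [phiE [f [g [chi etaE]]]]].
move: psiE phiE; rewrite etaE marginal_XW_displayed marginal_WY_displayed.
move=> psiE phiE.
(* The state [chi] from the display is arbitrary a priori; the marginal condition forces it to be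
   the common marginal on [W]. *)
have phiW : marginal_fst phi = chi by rewrite -phiE marginal_fst_tensm_copy.
exists chi, f, g; rewrite is_conditional_on_sndE is_conditional_on_fstE hW phiW.
by rewrite psiE phiE.
Qed.

Lemma is_conditional_product_unique X W Y (psi : hom unit_ob (X ⊗ W))
    (phi : hom unit_ob (W ⊗ Y)) (eta eta' : hom unit_ob ((X ⊗ W) ⊗ Y)) :
  is_conditional_product psi phi eta -> is_conditional_product psi phi eta' ->
  eta = eta'.
Proof.
move=> [omega [c [d [_ [phiW [hc [hd ->]]]]]]].
move=> [omega' [c' [d' [psiW' [phiW' [hc' [hd' ->]]]]]]].
(* Both [omega] and [omega'] are the marginal of [phi] on [W], hence equal. *)
move: phiW hc hc' hd hd'; rewrite phiW' => <-.
rewrite !is_conditional_on_sndE !is_conditional_on_fstE psiW' phiW'.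
by move=> hc hc' hd hd'; apply: displayed_eq; rewrite -?hc -?hd.
Qed.

Lemma is_conditional_product_exists (hC : has_conditionals C) X W Y
    (psi : hom unit_ob (X ⊗ W)) (phi : hom unit_ob (W ⊗ Y))
    (hW : marginal_snd psi = marginal_fst phi) :
  exists eta, is_conditional_product psi phi eta.
Proof.
have [c hc] := has_conditionals_on_fst hC (swap X W ∘ psi).
have [d hd] := has_conditionals_on_fst hC phi.
by eexists; exists (marginal_fst phi), c, d.
Qed.

End MarkovCategory.

Unset Implicit Arguments.
Set Strict Implicit.

Theorem proposition12p9 (C : markov_category) (hC : has_conditionals C)
    (X W Y : C) (psi : hom unit_ob (X ⊗ W)) (phi : hom unit_ob (W ⊗ Y))
    (hW : marginal_snd psi = marginal_fst phi) :
  exists eta : hom unit_ob ((X ⊗ W) ⊗ Y),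
    unique (is_conditional_product psi phi) eta /\
    unique (fun eta' : hom unit_ob ((X ⊗ W) ⊗ Y) =>
      marginal_XW eta' = psi /\ marginal_WY eta' = phi /\
      displays_cond_indep eta') eta.
Proof.
have [eta heta] := is_conditional_product_exists hC hW; exists eta.
split; split=> //.
- by move=> eta'; apply: is_conditional_product_unique.
- exact/is_conditional_productE.
(* Any competitor is itself a conditional product, so the uniqueness already proved applies. *)
- move=> eta' /(is_conditional_productE hW).
  exact: is_conditional_product_unique.
Qed.
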